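(* For every outer or dense diamond (the outer diamond $\Diamond_v^{\mathrm{out}}$ and the dense diamond $\Diamond_v$), the diagonal joining the base $v$ of the diamond to the vertex of the diamond which is the intersection of its two roofs is vertical.
   Context: **Initial rays.** $M=\mathbb Z^2$, $M_{\mathbb R}=\mathbb R^2$ with coordinates $(x,y)$. Rays $\mathfrak d=m_0-\mathbb R_{\ge0}m_{\mathfrak d}$ have opposite vector $m_{\mathfrak d}\in M$ (primitive) and direction vector $-m_{\mathfrak d}$. $\mathfrak d_n^+=(n,-n^2/2)-\mathbb R_{\ge0}(-1,n)$, $\mathfrak d_n^-=(n,-n^2/2)-\mathbb R_{\ge0}(1,-n)$, $n\in\mathbb Z$. **Triangles.** $T(x,y)=(x+1,\,y-x-\tfrac12)$. Let $\mathcal T$ be the infinite binary tree with root $w_0$, edges labelled hybrid or outgoing: both edges at $w_0$ are hybrid; for any other vertex, one of the edges to its two children is hybrid and the other outgoing. Each vertex $w$ gets a triangle $\Delta_w$ and each $w\ne w_0$ a ray $\mathfrak d_w$, inductively. $\Delta_{w_0}=\mathrm{Conv}((-\tfrac12,0),(\tfrac12,0),(0,\tfrac12))$; its edges at $(0,\tfrac12)$ lie in $\mathfrak d_{-1}^+,\mathfrak d_1^-$ and its bottom edge in $\mathfrak d_0^+\cup\mathfrak d_0^-$. Edges of triangles are oriented by the direction vectors of the rays containing them; a vertex of a triangle is incoming (outgoing) if both adjacent edges are oriented towards (away from) it, otherwise hybrid. For a vertex $v$ of $\Delta_w$ let $D_v=|m_1\wedge m_2|$ with $m_1,m_2$ primitive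 tangent vectors of the adjacent edges. Given $\Delta_w$ with incoming vertex $v$, adjacent edges $E_1,E_2$ with other endpoints $v_1,v_2$, lying in rays $\mathfrak d_1,\mathfrak d_2$, match $E_1,E_2$ with the edges of $\mathcal T$ from $w$ to its children $w_1,w_2$ so that $E_i$ is hybrid (outgoing) when $v_i$ is. Let $m_i$ be the primitive tangent vector of $E_i$ pointing from $v$ to $v_i$, $E$ the third edge, and for $\{j,j'\}=\{1,2\}$ let $m$ be the primitive tangent vector of $E$ pointing towards $v_j$. Set $\mathfrak d_{w_j}=v_j-\mathbb R_{\ge0}(3D_{v_j}m_j-m)$, $v_j'=\mathfrak d_{j'}\cap\mathfrak d_{w_j}$ and $\Delta_{w_j}=\mathrm{Conv}(E_j\cup\{v_j'\})$. Put $\mathfrak D^0_{\mathrm{discrete}}=\{\mathfrak d_w: w\neq w_0\}$. **Diamonds.** Let $v$ be either the incoming vertex of a triangle $\Delta_w$, with $m_1,m_2$ the opposite vectors of the two rays of $\{\mathfrak d_{-1}^+,\mathfrak d_1^-\}\cup\mathfrak D^0_{\mathrm{discrete}}$ containing the edges of $\Delta_w$ at $v$ and with roof rays $\mathfrak d_{w_1},\mathfrak d_{w_2}$ ($w_1,w_2$ the children of $w$); or an initial vertex $v=\mathfrak d_n^+\cap\mathfrak d_{n+1}^-$, with $D_v=1$, $m_1,m_2$ the opposite vectors of $\mathfrak d_n^+,\mathfrak d_{n+1}^-$ and roof rays $\mathfrak d_{n-1}^+,\mathfrak d_{n+2}^-$. Let $C_v$ be the closure of $\{v-(am_1+bm_2):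 a,b>0,\ \tfrac{3D_v-\sqrt{9D_v^2-4}}2<\tfrac ba<\tfrac{3D_v+\sqrt{9D_v^2-4}}2\}$ and $C_v^{\mathrm{out}}=v-(\mathbb R_{\ge0}m_1+\mathbb R_{\ge0}m_2)$. The dense diamond $\Diamond_v$ (resp. outer diamond $\Diamond_v^{\mathrm{out}}$) with base $v$ is the closure of the connected component containing $v$ of $C_v$ (resp. $C_v^{\mathrm{out}}$) minus the two roof rays; for $k\in\mathbb Z$ the diamonds based at $T^k(v)$ are the images under $T^k$. Each is a quadrilateral, whose two upper edges (on the roof rays) are its roofs. *)

(* Defs.v *)
From mathcomp Require Import all_boot all_order all_algebra.
From mathcomp Require Import all_classical all_reals all_analysis.
From mathcomp Require Import ring.

Set Implicit Arguments.
Unset Strict Implicit.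
Unset Printing Implicit Defensive.
Import Order.TTheory GRing.Theory Num.Theory.
Import numFieldNormedType.Exports.

Local Open Scope classical_set_scope.
Local Open Scope ring_scope.

(* M = Z^2 *)
Notation lattice := (int * int)%type.

Definition wedge (m m' : lattice) : int := m.1 * m'.2 - m.2 * m'.1.

Definition primitive (m : lattice) : Prop := coprimez m.1 m.2.

(* [R^o] rather than [R] makes [*:] available; the topology is the usual one. *)
Notation plane R := (R^o * R^o)%type.

(* A ray is given by its initial point m0 and its opposite vector m_d; it is
   traversed in the direction of - m_d. *)
Notation ray R := (plane R * lattice)%type.

Section Plane.
Context {R : realType}.
Implicit Types (p q r v : plane R) (d : ray R) (m : lattice) (n : int).

Definition vec m : plane R := (m.1%:~R, m.2%:~R).

Definition ray_set d : set (plane R) :=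
  [set p | exists2 t : R, 0 <= t & p = d.1 - t *: vec d.2].

Definition parabola_point n : plane R := (n%:~R, - (n%:~R ^+ 2) / 2).
Definition ray_plus n : ray R := (parabola_point n, (- 1, n)).
Definition ray_minus n : ray R := (parabola_point n, (1, - n)).

Definition meet_point d d' : plane R :=
  xget (0, 0) (ray_set d `&` ray_set d').

Definition segment p q : set (plane R) :=
  [set z | exists2 t : R, 0 <= t <= 1 & z = (1 - t) *: p + t *: q].

(* the member of the family S of rays that contains the edge [p, q] *)
Definition ray_through (S : set (ray R)) p q : ray R :=
  xget ((0, 0), (0, 0)) [set d | S d /\ segment p q `<=` ray_set d].

(* u and u' span the same half-line *)
Definition same_direction (u u' : plane R) : Prop :=
  exists2 t : R, 0 < t & u = t *: u'.

(* the primitive tangent vector of the edge [p, q] pointing from p to q *)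
Definition prim_tangent p q : lattice :=
  xget (0, 0) [set m | primitive m /\ same_direction (q - p) (vec m)].

(* D_v for a triangle with vertices v, p, q *)
Definition corner_mult v p q : int :=
  `|wedge (prim_tangent v p) (prim_tangent v q)|.

(* The edge [p, q], covered by the rays of S, is oriented towards p, resp.
   away from p.  S may have two members, see [root_triangle]; the ray that
   decides the orientation near p is the one that contains p. *)
Definition oriented_to (S : set (ray R)) p q : Prop :=
  exists2 d, S d & ray_set d p /\ same_direction (p - q) (- vec d.2).
Definition oriented_from (S : set (ray R)) p q : Prop :=
  exists2 d, S d & ray_set d p /\ same_direction (q - p) (- vec d.2).

(* A triangle Conv(vtx 0, vtx 1, vtx 2); [sides k] is the set of the rays that
   cover the edge opposite to [vtx k]. *)
Record triangle := Triangle {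
  vtx : 'I_3 -> plane R;
  sides : 'I_3 -> set (ray R) }.

Definition mk_triangle (p q r : plane R) (Sp Sq Sr : set (ray R)) : triangle :=
  Triangle (fun i => tnth [tuple p; q; r] i) (fun i => tnth [tuple Sp; Sq; Sr] i).

Definition incoming (D : triangle) (i : 'I_3) : Prop :=
  forall j k, uniq [:: i; j; k] -> oriented_to (sides D k) (vtx D i) (vtx D j).
Definition outgoing (D : triangle) (i : 'I_3) : Prop :=
  forall j k, uniq [:: i; j; k] -> oriented_from (sides D k) (vtx D i) (vtx D j).
Definition hybrid (D : triangle) (i : 'I_3) : Prop :=
  ~ incoming D i /\ ~ outgoing D i.

Inductive label := Hybrid | Outgoing.

Definition has_label (D : triangle) (i : 'I_3) (l : label) : Prop :=
  match l with Hybrid => hybrid D i | Outgoing => outgoing D i end.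

(* A vertex of the tree is the list of the choices leading to it from the root
   [::], last choice first: the children of w are true :: w and false :: w. *)
Definition edge_label (w : seq bool) (b : bool) : label :=
  if w is [::] then Hybrid else if b then Hybrid else Outgoing.

(* (i, j, j') such that vtx i is the incoming vertex and the edges from vtx i
   to vtx j and vtx j' are matched with the tree edges to the children true and
   false.  For the root triangle two matchings are possible, and one of them is
   chosen. *)
Definition matching (D : triangle) (l : bool -> label) : 'I_3 * 'I_3 * 'I_3 :=
  xget (ord0, ord0, ord0)
    [set s | [/\ uniq [:: s.1.1; s.1.2; s.2], incoming D s.1.1,
                 has_label D s.1.2 (l true) & has_label D s.2 (l false)]].

Definition in_index (D : triangle) (l : bool -> label) : 'I_3 :=
  (matching D l).1.1.
Definition end_index (D : triangle) (l : bool -> label) (b : bool) : 'I_3 :=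
  if b then (matching D l).1.2 else (matching D l).2.

(* v_j - R_{>=0} (3 D_{v_j} m_j - m), where vj' is the third vertex *)
Definition new_ray v (vj vj' : plane R) : ray R :=
  (vj, prim_tangent v vj *~ (3 * corner_mult vj v vj') - prim_tangent vj' vj).

Definition child_ray (D : triangle) (l : bool -> label) (b : bool) : ray R :=
  new_ray (vtx D (in_index D l)) (vtx D (end_index D l b))
    (vtx D (end_index D l (~~ b))).

Definition child_triangle (D : triangle) (l : bool -> label) (b : bool) :
    triangle :=
  let v := vtx D (in_index D l) in
  let vj := vtx D (end_index D l b) in
  let vj' := vtx D (end_index D l (~~ b)) in
  let dj := ray_through (sides D (end_index D l (~~ b))) v vj in
  let dj' := ray_through (sides D (end_index D l b)) v vj' in
  let dw := child_ray D l b in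
  mk_triangle (meet_point dj' dw) v vj [set dj] [set dw] [set dj'].

Definition root_triangle : triangle :=
  mk_triangle (0, 1 / 2) (- (1 / 2), 0) (1 / 2, 0)
    [set ray_plus 0; ray_minus 0] [set ray_minus 1] [set ray_plus (- 1)].

Fixpoint tree_triangle (w : seq bool) : triangle :=
  if w is b :: w' then child_triangle (tree_triangle w') (edge_label w') b
  else root_triangle.

(* the ray d_{w_b} attached to the child w_b = b :: w of w *)
Definition tree_ray (w : seq bool) (b : bool) : ray R :=
  child_ray (tree_triangle w) (edge_label w) b.

Definition discrete_rays : set (ray R) :=
  [set d | exists w b, d = tree_ray w b].

Definition incoming_vertex (w : seq bool) : plane R :=
  vtx (tree_triangle w) (in_index (tree_triangle w) (edge_label w)).
Definition end_vertex (w : seq bool) (b : bool) : plane R :=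
  vtx (tree_triangle w) (end_index (tree_triangle w) (edge_label w) b).

(* The data that determine the two diamonds with a given base: v, D_v, the
   opposite vectors m_1, m_2 and the two roof rays. *)
Record frame := Frame {
  base : plane R;
  mult : int;
  opp1 : lattice;
  opp2 : lattice;
  roof_ray1 : ray R;
  roof_ray2 : ray R }.

Definition triangle_frame (w : seq bool) : frame :=
  let S := [set ray_plus (- 1); ray_minus 1] `|` discrete_rays in
  let v := incoming_vertex w in
  Frame v (corner_mult v (end_vertex w true) (end_vertex w false))
    (ray_through S v (end_vertex w true)).2
    (ray_through S v (end_vertex w false)).2
    (tree_ray w true) (tree_ray w false).

Definition initial_frame n : frame :=
  Frame (meet_point (ray_plus n) (ray_minus (n + 1))) 1
    (ray_plus n).2 (ray_minus (n + 1)).2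
    (ray_plus (n - 1)) (ray_minus (n + 2)).

Definition is_frame (F : frame) : Prop :=
  (exists w, F = triangle_frame w) \/ (exists n, F = initial_frame n).

Definition dense_cone (F : frame) : set (plane R) :=
  let D : R := (mult F)%:~R in
  let s := Num.sqrt (9 * D ^+ 2 - 4) in
  closure [set p | exists a b : R,
    [/\ 0 < a, 0 < b, (3 * D - s) / 2 < b / a < (3 * D + s) / 2
      & p = base F - (a *: vec (opp1 F) + b *: vec (opp2 F))]].

Definition outer_cone (F : frame) : set (plane R) :=
  [set p | exists a b : R,
    [/\ 0 <= a, 0 <= b
      & p = base F - (a *: vec (opp1 F) + b *: vec (opp2 F))]].

Definition cut_cone (F : frame) (C : set (plane R)) : set (plane R) :=
  closure (connected_component
    (C `\` (ray_set (roof_ray1 F) `|` ray_set (roof_ray2 F))) (base F)).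

Inductive diamond_kind := Dense | Outer.

Definition diamond (K : diamond_kind) (F : frame) : set (plane R) :=
  cut_cone F (match K with Dense => dense_cone F | Outer => outer_cone F end).

Definition roof1 (K : diamond_kind) (F : frame) : set (plane R) :=
  diamond K F `&` ray_set (roof_ray1 F).
Definition roof2 (K : diamond_kind) (F : frame) : set (plane R) :=
  diamond K F `&` ray_set (roof_ray2 F).

Definition shear p : plane R := (p.1 + 1, p.2 - p.1 - 1 / 2).
Definition shear_inv p : plane R := (p.1 - 1, p.2 + p.1 - 1 / 2).

Lemma shearK : cancel shear shear_inv.
Proof. by case=> x y; rewrite /shear /shear_inv /=; congr pair; field. Qed.

Lemma shear_invK : cancel shear_inv shear.
Proof. by case=> x y; rewrite /shear /shear_inv /=; congr pair; field. Qed.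

(* T^k for the map T = shear *)
Definition shear_pow (k : int) : plane R -> plane R :=
  match k with Posz n => iter n shear | Negz n => iter n.+1 shear_inv end.

(* extreme points, i.e., the vertices when A is a convex polygon *)
Definition is_vertex (A : set (plane R)) (u : plane R) : Prop :=
  A u /\ forall p q (t : R), A p -> A q -> 0 < t < 1 ->
    u = (1 - t) *: p + t *: q -> p = u /\ q = u.

Definition vertical_segment p q : Prop := p <> q /\ p.1 = q.1.

End Plane.

Arguments triangle : clear implicits.
Arguments frame : clear implicits.

(* Main.v *)
Require Import Defs.
From mathcomp Require Import all_boot all_order all_algebra.
From mathcomp Require Import all_classical all_reals all_analysis.
From mathcomp Require Import ring lra zify.
Import Order.TTheory GRing.Theory Num.Theory.
Import numFieldNormedType.Exports.
Local Open Scope classical_set_scope.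
Local Open Scope ring_scope.

(* The corner multiplicities of every triangle form a Markov triple
   D^2 + D1^2 + D2^2 = 3 D D1 D2, and passing to a child is a Vieta jump
   (D, D1, D2) -> (3 D D1 - D2, D, D1).  If m1, m2 are the primitive tangent
   vectors at the incoming vertex v, then D1 m1 + D2 m2 is vertical; this is
   preserved by the jump, again because of the Markov equation.  In the
   coordinates p = v - (a m1 + b m2) the Markov equation gives that the two roofs
   meet on the line a : b = D1 : D2, that is, vertically above v.  The initial
   diamonds are the case D = D1 = D2 = 1.

   The opposite vectors of a frame are read off rays of the whole diagram
   containing the edges at v.  They do not depend on the choice of these rays
   since all rays are primitive and y + x^2/2 increases along each of them, so
   that two overlapping rays point in the same direction. *)

Set Implicit Arguments.
Unset Strict Implicit.

(** * Cutting a star-shaped set by two lines *)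

Section Star.
Context {R : realType}.
Implicit Types (p q v u : plane R) (A C B : set (plane R)).

Lemma fst_mix p q (t : R) : ((1 - t) *: p + t *: q).1 = (1 - t) * p.1 + t * q.1.
Proof. by []. Qed.

Lemma snd_mix p q (t : R) : ((1 - t) *: p + t *: q).2 = (1 - t) * p.2 + t * q.2.
Proof. by []. Qed.

Lemma plane_eq p q : p.1 = q.1 -> p.2 = q.2 -> p = q.
Proof. by case: p q => a b [c d] /= -> ->. Qed.

Lemma mix0 p q : (1 - 0) *: p + 0 *: q = p.
Proof. by rewrite subr0 scale1r scale0r addr0. Qed.

Lemma mix1 p q : (1 - 1) *: p + 1 *: q = q.
Proof. by rewrite subrr scale1r scale0r add0r. Qed.

Lemma continuous_mix p q : continuous (fun t : R => (1 - t) *: p + t *: q).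
Proof.
move=> t; apply: cvgD; apply: cvgZr_tmp; last exact: cvg_id.
by apply: cvgB; [exact: cvg_cst | exact: cvg_id].
Qed.

Lemma continuous_mixl (t : R) v : continuous (fun p => (1 - t) *: p + t *: v).
Proof.
move=> p; apply: cvgD; last exact: cvg_cst.
by apply: cvgZl_tmp; exact: cvg_id.
Qed.

Definition affine_map (f : plane R -> plane R) :=
  forall p q (t : R), f ((1 - t) *: p + t *: q) = (1 - t) *: f p + t *: f q.

Definition affine_form (f : plane R -> R) :=
  exists c0 c1 c2, forall p, f p = c0 + c1 * p.1 + c2 * p.2.

Lemma affine_form_mix f p q (t : R) : affine_form f ->
  f ((1 - t) *: p + t *: q) = (1 - t) * f p + t * f q.
Proof. by move=> [c0 [c1 [c2 fE]]]; rewrite !fE fst_mix snd_mix; ring. Qed.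

Lemma continuous_affine_form f : affine_form f -> continuous f.
Proof.
move=> [c0 [c1 [c2 /funext->]]] p.
apply: cvgD; first apply: cvgD; first exact: cvg_cst.
- by apply: cvgM; [exact: cvg_cst | exact: cvg_fst].
- by apply: cvgM; [exact: cvg_cst | exact: cvg_snd].
Qed.

Lemma affine_form_comb (f g : plane R -> R) (a b c : R) :
  affine_form f -> affine_form g -> affine_form (fun p => a * f p + b * g p + c).
Proof.
move=> [x0 [x1 [x2 fE]]] [y0 [y1 [y2 gE]]].
exists (a * x0 + b * y0 + c), (a * x1 + b * y1), (a * x2 + b * y2) => p.
by rewrite fE gE; ring.
Qed.

Lemma closed_affine_ge0 f : affine_form f -> closed [set p | 0 <= f p].
Proof.
move=> /continuous_affine_form cf.
apply: (preimage_closed (f := f) _ (@closed_ge R 0)) => p _; exact: cf.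
Qed.

Definition star_shaped v A :=
  forall p (t : R), A p -> 0 <= t <= 1 -> A ((1 - t) *: p + t *: v).

Lemma closure_segment A p v :
  (forall t : R, 0 < t <= 1 -> A ((1 - t) *: p + t *: v)) -> closure A p.
Proof.
move=> Apv B pB.
have /nbhs_ballP[e /= e0 Be] : nbhs (0 : R) [set t | B ((1 - t) *: p + t *: v)].
  by apply: (@continuous_mix p v 0); rewrite mix0.
pose t := Num.min 1 (e / 2).
have t0 : 0 < t by rewrite lt_min ltr01 divr_gt0.
exists ((1 - t) *: p + t *: v); split.
- by apply: Apv; rewrite t0 ge_min lexx.
- apply: Be; rewrite /ball /= sub0r normrN gtr0_norm// gt_min.
  by apply/orP; right; lra.
Qed.

(** The hypothesis stops short of [t = 1] because an open cone does not contain its own apex; the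
    closure recovers that case. *)
Lemma star_shaped_closure v A : (forall p (t : R), A p -> 0 <= t < 1 ->
  A ((1 - t) *: p + t *: v)) -> star_shaped v (closure A).
Proof.
move=> starA p t cAp /andP[t0 t1].
have starcA s q : 0 <= s < 1 -> closure A q -> closure A ((1 - s) *: q + s *: v).
  move=> s01 cAq B /(@continuous_mixl s v q)/cAq[r [Ar Br]].
  by exists ((1 - s) *: r + s *: v); split => //; exact: starA.
(* For [t = 1] the point is [v] itself, a limit of the points of the segment from [v] to [p]; the
   segment is parametrized backwards from here on. *)
have [->|tn1] := eqVneq t 1; last by apply: starcA; rewrite // t0 lt_neqAle tn1.
rewrite mix1; apply: (@closed_closure _ A).
apply: (@closure_segment _ _ p) => s /andP[s0 s1].
rewrite addrC -{1}[s](subKr 1); apply: starcA => //; lra.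
Qed.

(** An affine form without zeros on a connected set keeps its sign there, so the component lies
    where both forms are positive. Conversely, moving from a point with [f1, f2 >= 0] towards [v]
    makes both forms positive at once, so such a point is a limit of points joined to [v] inside [C]
    off the two sets. *)
Lemma component_sides C (r1 r2 : set (plane R)) (f1 f2 : plane R -> R) v :
  closed C -> C v -> star_shaped v C -> affine_form f1 -> affine_form f2 ->
  0 < f1 v -> 0 < f2 v ->
  (forall p, C p -> (r1 p <-> f1 p = 0)) ->
  (forall p, C p -> (r2 p <-> f2 p = 0)) ->
  closure (connected_component (C `\` (r1 `|` r2)) v) =
  [set p | [/\ C p, 0 <= f1 p & 0 <= f2 p]].
Proof.
move=> clC Cv starC af1 af2 f1v f2v r1E r2E.
set A := C `\` _.
have pos f p : affine_form f -> 0 < f v -> (forall q, A q -> f q != 0) ->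
    connected_component A v p -> 0 < f p.
  move=> af fv fA Ap; rewrite ltNge; apply/negP => fp.
  have : connected (f @` connected_component A v).
    apply: connected_continuous_connected; first exact: component_connected.
    by apply: continuous_subspaceT; exact: continuous_affine_form.
  move=> /connected_intervalP itv.
  have [|||q /connected_component_sub/fA/negP fq fq0] := itv (f p) (f v) _ _ 0.
  - by exists p.
  - exists v => //; apply: connected_component_refl; split=> //.
    by move=> [/(r1E _ Cv)|/(r2E _ Cv)] E; move: f1v f2v; rewrite E ltxx.
  - by rewrite fp (ltW fv).
  - exact/fq/eqP.
apply/seteqP; split.
  have cl : closed [set p | [/\ C p, 0 <= f1 p & 0 <= f2 p]].
    rewrite (_ : mkset _ = C `&` [set p | 0 <= f1 p] `&` [set p | 0 <= f2 p]).
      by apply: closedI; [apply: closedI => // |]; exact: closed_affine_ge0.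
    by apply/seteqP; split => p /=; [case | case=> -[]].
  rewrite [X in _ `<=` X](closure_id _).1 //; apply: closure_subset => p cp.
  have [Cp _] := connected_component_sub cp.
  split=> //; apply: ltW; apply: pos cp => // q [Cq nq]; apply/negP => /eqP fq.
  - by apply: nq; left; exact/r1E.
  - by apply: nq; right; exact/r2E.
move=> p [Cp f1p f2p]; apply: (@closure_segment _ _ v) => t /andP[t0 t1].
(* The segment is cut off at parameter [t > 0], since [p] itself may lie on one of the removed
   sets. *)
pose B := (fun s : R => (1 - s) *: p + s *: v) @` `[t, 1].
have BA : B `<=` A.
  move=> _ [s /= + <-]; rewrite in_itv /= => /andP[ts s1].
  have s0 : 0 < s by exact: lt_le_trans ts.
  have Cs : C ((1 - s) *: p + s *: v) by apply: starC; rewrite // s1 (ltW s0).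
  have fs f : affine_form f -> 0 <= f p -> 0 < f v ->
      f ((1 - s) *: p + s *: v) <> 0.
    move=> af fp fv; rewrite affine_form_mix //; apply/eqP; rewrite gt_eqF //.
    by rewrite ltr_wpDl ?mulr_ge0 ?mulr_gt0 // subr_ge0.
  by split=> // -[/(r1E _ Cs)|/(r2E _ Cs)]; exact: fs.
have Bc : connected B.
  apply: connected_continuous_connected; first exact: segment_connected.
  by apply: continuous_subspaceT; exact: continuous_mix.
apply: (connected_component_max _ BA Bc).
- by exists 1; rewrite ?mix1 //= in_itv /= t1 lexx.
- by exists t; rewrite //= in_itv /= t1 lexx.
Qed.

(** * Affine images and powers of the shear *)

Lemma is_vertex_image (f : plane R -> plane R) A u :
  affine_map f -> injective f -> is_vertex A u -> is_vertex (f @` A) (f u).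
Proof.
move=> af If [Au vu]; split; first by exists u.
move=> _ _ t [p Ap <-] [q Aq <-] t01; rewrite -af => /If /(vu _ _ _ Ap Aq t01).
by move=> [-> ->].
Qed.

Lemma affine_shear : affine_map (@shear R).
Proof. by move=> p q t; apply: plane_eq; rewrite /= /GRing.scale /=; ring. Qed.

Lemma affine_shear_inv : affine_map (@shear_inv R).
Proof. by move=> p q t; apply: plane_eq; rewrite /= /GRing.scale /=; ring. Qed.

Lemma affine_shear_pow k : affine_map (@shear_pow R k).
Proof.
have iterP f n : affine_map f -> affine_map (iter n f).
  by move=> af p q t; elim: n => [//|n IH]; rewrite !iterS IH af.
by case: k => n; apply: iterP; [exact: affine_shear | exact: affine_shear_inv].
Qed.

Lemma shear_pow_inj k : injective (@shear_pow R k).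
Proof.
have iterP f n : injective f -> injective (@iter (plane R) n f).
  by move=> If; elim: n => [|n IH] p q //; rewrite !iterS => /If/IH.
by case: k => n; apply: iterP; [exact: can_inj shearK | exact: can_inj shear_invK].
Qed.

Lemma shear_pow_vertical k p q : p.1 = q.1 ->
  (@shear_pow R k p).1 = (shear_pow k q).1.
Proof.
have iterP f n : (forall p q, p.1 = q.1 -> (f p).1 = (f q).1) ->
    p.1 = q.1 -> (@iter (plane R) n f p).1 = (iter n f q).1.
  by move=> fP pq; elim: n => [//|n IH]; rewrite !iterS; exact: fP.
by case: k => n; apply: iterP => {}p {}q /= ->.
Qed.

End Star.

(** * Diamonds over Markov triples *)

(* D1 and D2 are the multiplicities at the ends of the edges at the base, and lam is
   the scale of the frame.  The i-th roof ray meets the i-th edge ray at time th_i: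
   0 in a triangle, 1/2 in an initial frame. *)
Record markov_frame {R : realType} (F : frame R) (D1 D2 lam th1 th2 : R) : Prop :=
  MarkovFrame {
  mf_mult : 0 < (mult F)%:~R :> R;
  mf_D1 : 0 < D1;
  mf_D2 : 0 < D2;
  mf_lam : 0 < lam;
  mf_th1 : 0 <= th1;
  mf_th2 : 0 <= th2;
  mf_markov : (mult F)%:~R ^+ 2 + D1 ^+ 2 + D2 ^+ 2 = 3 * (mult F)%:~R * D1 * D2;
  mf_wedge : wedge (opp1 F) (opp2 F) != 0;
  mf_vertical : D1 * (opp1 F).1%:~R + D2 * (opp2 F).1%:~R = 0;
  mf_dir1 : (mult F)%:~R *: vec (roof_ray1 F).2 =
    (3 * (mult F)%:~R * D1 - D2) *: vec (opp1 F) + D1 *: vec (opp2 F);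
  mf_dir2 : (mult F)%:~R *: vec (roof_ray2 F).2 =
    D2 *: vec (opp1 F) + (3 * (mult F)%:~R * D2 - D1) *: vec (opp2 F);
  mf_start1 : (roof_ray1 F).1 =
    base F + (lam * D2) *: vec (opp1 F) + th1 *: vec (roof_ray1 F).2;
  mf_start2 : (roof_ray2 F).1 =
    base F + (lam * D1) *: vec (opp2 F) + th2 *: vec (roof_ray2 F).2 }.

Section MarkovFrame.
Context {R : realType} (F : frame R) (D1 D2 lam th1 th2 : R).
Hypothesis mF : markov_frame F D1 D2 lam th1 th2.
Implicit Types (p q : plane R) (a b t : R).

Let D : R := (mult F)%:~R.
Let v := base F.
Let e1 : plane R := vec (opp1 F).
Let e2 : plane R := vec (opp2 F).
Let w : R := e1.1 * e2.2 - e1.2 * e2.1.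

Let D_gt0 : 0 < D := mf_mult mF.
Let D1_gt0 : 0 < D1 := mf_D1 mF.
Let D2_gt0 : 0 < D2 := mf_D2 mF.
Let lam_gt0 : 0 < lam := mf_lam mF.
Let D_neq0 : D != 0. Proof. exact: lt0r_neq0. Qed.
Let D1_neq0 : D1 != 0. Proof. exact: lt0r_neq0. Qed.
Let D2_neq0 : D2 != 0. Proof. exact: lt0r_neq0. Qed.
Let markov : D ^+ 2 + D1 ^+ 2 + D2 ^+ 2 = 3 * D * D1 * D2 := mf_markov mF.

Let w_neq0 : w != 0.
Proof.
by have := mf_wedge mF; rewrite -(intr_eq0 R) /wedge rmorphB !rmorphM.
Qed.

(** * Coordinates at the base and the meeting point of the roofs *)

Definition frame_point a b : plane R := v - (a *: e1 + b *: e2).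

(** Cramer's rule for [p = v - (a *: e1 + b *: e2)], with determinant [w]. *)
Definition coord1 p : R := ((v.1 - p.1) * e2.2 - (v.2 - p.2) * e2.1) / w.
Definition coord2 p : R := ((v.2 - p.2) * e1.1 - (v.1 - p.1) * e1.2) / w.

Lemma frame_pointK1 a b : coord1 (frame_point a b) = a.
Proof. by rewrite /coord1 /w /= /GRing.scale /=; field; exact: w_neq0. Qed.

Lemma frame_pointK2 a b : coord2 (frame_point a b) = b.
Proof. by rewrite /coord2 /w /= /GRing.scale /=; field; exact: w_neq0. Qed.

Lemma coordK p : frame_point (coord1 p) (coord2 p) = p.
Proof.
by apply: plane_eq; rewrite /coord1 /coord2 /w /= /GRing.scale /=; field; exact: w_neq0.
Qed.

Lemma affine_coord1 : affine_form coord1.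
Proof.
exists ((v.1 * e2.2 - v.2 * e2.1) / w), (- e2.2 / w), (e2.1 / w) => p.
by rewrite /coord1; field.
Qed.

Lemma affine_coord2 : affine_form coord2.
Proof.
exists ((v.2 * e1.1 - v.1 * e1.2) / w), (e1.2 / w), (- e1.1 / w) => p.
by rewrite /coord2; field.
Qed.

Lemma coord_base : coord1 v = 0 /\ coord2 v = 0.
Proof. by rewrite /coord1 /coord2 !subrr !mul0r !subrr !mul0r. Qed.

(* side1 and side2 vanish on the lines through the two roof rays. *)
Definition side1 p :=
  D1 * coord1 p + - (3 * D * D1 - D2) * coord2 p + lam * D1 * D2.
Definition side2 p :=
  - (3 * D * D2 - D1) * coord1 p + D2 * coord2 p + lam * D1 * D2.

Lemma affine_side1 : affine_form side1.
Proof. exact: affine_form_comb affine_coord1 affine_coord2. Qed.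

Lemma affine_side2 : affine_form side2.
Proof. exact: affine_form_comb affine_coord1 affine_coord2. Qed.

(** At [t = th1] the roof ray is at the point [v + (lam * D2) *: e1] of the first edge line; from
    there it moves along its direction written in the basis [e1, e2]. *)
Lemma ray1_point t : (roof_ray1 F).1 - t *: vec (roof_ray1 F).2 =
  frame_point ((t - th1) * (3 * D * D1 - D2) / D - lam * D2) ((t - th1) * D1 / D).
Proof.
have E : vec (roof_ray1 F).2 =
    ((3 * D * D1 - D2) / D) *: e1 + (D1 / D) *: e2 :> plane R.
  by rewrite -[LHS](scalerK D_neq0) (mf_dir1 mF) scalerDr !scalerA !(mulrC D^-1).
rewrite (mf_start1 mF) E.
by apply: plane_eq; rewrite /= /GRing.scale /= -/e1 -/e2; field.
Qed.

Lemma ray2_point t : (roof_ray2 F).1 - t *: vec (roof_ray2 F).2 =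
  frame_point ((t - th2) * D2 / D) ((t - th2) * (3 * D * D2 - D1) / D - lam * D1).
Proof.
have E : vec (roof_ray2 F).2 =
    (D2 / D) *: e1 + ((3 * D * D2 - D1) / D) *: e2 :> plane R.
  by rewrite -[LHS](scalerK D_neq0) (mf_dir2 mF) scalerDr !scalerA !(mulrC D^-1).
rewrite (mf_start2 mF) E.
by apply: plane_eq; rewrite /= /GRing.scale /= -/e1 -/e2; field.
Qed.

(** The line [side1 = 0] is longer than the ray, but the second coordinate increases along the ray
    and is already nonpositive at its initial point, so nothing with [coord2 p >= 0] is lost. *)
Lemma ray1_side p : 0 <= coord2 p -> ray_set (roof_ray1 F) p <-> side1 p = 0.
Proof.
move=> p2; split=> [[t _ ->]|].
  by rewrite ray1_point /side1 frame_pointK1 frame_pointK2; field.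
rewrite /side1 => s0.
have c1 : coord1 p = ((3 * D * D1 - D2) * coord2 p - lam * D1 * D2) / D1.
  by apply: (mulfI D1_neq0); apply/eqP; rewrite -subr_eq0 -s0; apply/eqP; field.
exists (th1 + coord2 p * D / D1).
  exact: addr_ge0 (mf_th1 mF) (divr_ge0 (mulr_ge0 p2 (ltW D_gt0)) (ltW D1_gt0)).
rewrite ray1_point -{1}[p]coordK c1.
by congr frame_point; field; rewrite ?D1_neq0 ?D2_neq0 D_neq0.
Qed.

Lemma ray2_side p : 0 <= coord1 p -> ray_set (roof_ray2 F) p <-> side2 p = 0.
Proof.
move=> p1; split=> [[t _ ->]|].
  by rewrite ray2_point /side2 frame_pointK1 frame_pointK2; field.
rewrite /side2 => s0.
have c2 : coord2 p = ((3 * D * D2 - D1) * coord1 p - lam * D1 * D2) / D2.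
  by apply: (mulfI D2_neq0); apply/eqP; rewrite -subr_eq0 -s0; apply/eqP; field.
exists (th2 + coord1 p * D / D2).
  exact: addr_ge0 (mf_th2 mF) (divr_ge0 (mulr_ge0 p1 (ltW D_gt0)) (ltW D2_gt0)).
rewrite ray2_point -{1}[p]coordK c2.
by congr frame_point; field; rewrite ?D1_neq0 ?D2_neq0 D_neq0.
Qed.

(** At the point with coordinates [s * D1, s * D2] the Markov equation turns both side forms into
    [lam * D1 * D2 - s * D ^+ 2]; the apex is the choice of [s] that makes this zero. *)
Definition apex : plane R :=
  frame_point (lam * D1 ^+ 2 * D2 / D ^+ 2) (lam * D1 * D2 ^+ 2 / D ^+ 2).

Lemma side_apex : side1 apex = 0 /\ side2 apex = 0.
Proof.
rewrite /side1 /side2 frame_pointK1 frame_pointK2.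
have -> : D1 * (lam * D1 ^+ 2 * D2 / D ^+ 2) +
    - (3 * D * D1 - D2) * (lam * D1 * D2 ^+ 2 / D ^+ 2) + lam * D1 * D2 =
    lam * D1 * D2 / D ^+ 2 * (D ^+ 2 + D1 ^+ 2 + D2 ^+ 2 - 3 * D * D1 * D2).
  by field.
have -> : - (3 * D * D2 - D1) * (lam * D1 ^+ 2 * D2 / D ^+ 2) +
    D2 * (lam * D1 * D2 ^+ 2 / D ^+ 2) + lam * D1 * D2 =
    lam * D1 * D2 / D ^+ 2 * (D ^+ 2 + D1 ^+ 2 + D2 ^+ 2 - 3 * D * D1 * D2).
  by field.
by rewrite markov subrr mulr0.
Qed.

Lemma side_eq0 p : side1 p = 0 -> side2 p = 0 -> p = apex.
Proof.
move=> s1 s2.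
(* [side1 - side2] equals [3 * D] times this expression. *)
have E : D2 * coord1 p - D1 * coord2 p = 0.
  apply: (mulfI D_neq0); apply: (@mulfI _ 3) => //.
  rewrite !mulr0 -(subr0 0) -{1}s1 -s2 /side1 /side2; ring.
have c2 : coord2 p = lam * D1 * D2 ^+ 2 / D ^+ 2.
  apply: (@mulfI _ (D ^+ 2)); first by rewrite expf_neq0.
  rewrite [RHS]mulrC divfK ?expf_neq0 //; apply/eqP; rewrite -subr_eq0; apply/eqP.
  have -> : D ^+ 2 * coord2 p - lam * D1 * D2 ^+ 2 =
    D1 * (D2 * coord1 p - D1 * coord2 p)
    + (D ^+ 2 + D1 ^+ 2 + D2 ^+ 2 - 3 * D * D1 * D2) * coord2 p - D2 * side1 p.
    by rewrite /side1; ring.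
  by rewrite E s1 markov subrr !(mulr0, mul0r) subr0 addr0.
have c1 : coord1 p = lam * D1 ^+ 2 * D2 / D ^+ 2.
  apply: (mulfI D2_neq0); apply/eqP; rewrite -subr_eq0 -E c2; apply/eqP.
  by field.
by rewrite -[LHS]coordK c1 c2.
Qed.

(** The apex is reached from the base by a multiple of [D1 m1 + D2 m2], which is vertical. It
    differs from the base because [side1] takes the value [lam * D1 * D2 > 0] there. *)
Lemma apex_above : base F <> apex /\ (base F).1 = apex.1.
Proof.
have tau0 : 0 < lam * D1 * D2 / D ^+ 2 by rewrite divr_gt0 ?exprn_gt0 ?mulr_gt0.
split=> [E|].
  have [s1 _] := side_apex; move: s1; rewrite -E /side1 -/v.
  have [-> ->] := coord_base; rewrite !mulr0 !add0r => /eqP.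
  by rewrite !mulf_eq0 !gt_eqF.
rewrite /= /GRing.scale /= -/v.
have -> : lam * D1 ^+ 2 * D2 / D ^+ 2 * (opp1 F).1%:~R +
    lam * D1 * D2 ^+ 2 / D ^+ 2 * (opp2 F).1%:~R =
    lam * D1 * D2 / D ^+ 2 *
    (D1 * (opp1 F).1%:~R + D2 * (opp2 F).1%:~R) by field.
by rewrite (mf_vertical mF) mulr0 subr0.
Qed.

(** * The two cones are closed, star-shaped and contain the apex *)

Lemma outer_coneE : outer_cone F = [set p | 0 <= coord1 p /\ 0 <= coord2 p].
Proof.
apply/seteqP; split=> [p [a [b [a0 b0 ->]]]|p [p1 p2]].
  by rewrite /= -/(frame_point a b) frame_pointK1 frame_pointK2.
by exists (coord1 p), (coord2 p); split; rewrite -?/(frame_point _ _) ?coordK.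
Qed.

Lemma closed_outer_cone : closed (outer_cone F).
Proof.
rewrite outer_coneE.
apply: closedI; apply: closed_affine_ge0; [exact: affine_coord1|exact: affine_coord2].
Qed.

Lemma star_outer_cone : star_shaped v (outer_cone F).
Proof.
rewrite outer_coneE => p t [p1 p2] /andP[t0 t1].
have [v1 v2] := coord_base.
rewrite /= (affine_form_mix _ _ _ affine_coord1) (affine_form_mix _ _ _ affine_coord2).
by rewrite v1 v2 !mulr0 !addr0; split; apply: mulr_ge0; rewrite ?subr_ge0.
Qed.

Lemma outer_cone_apex : outer_cone F apex.
Proof.
rewrite outer_coneE /= frame_pointK1 frame_pointK2.
by split; rewrite divr_ge0 ?mulr_ge0 ?exprn_ge0 // ltW.
Qed.

Lemma dense_cone_sub : dense_cone F `<=` outer_cone F.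
Proof.
rewrite [X in _ `<=` X](closure_id _).1; last exact: closed_outer_cone.
apply: closure_subset => p [a [b [a0 b0 _ ->]]].
by exists a, b; split=> //; exact: ltW.
Qed.

Lemma star_dense_cone : star_shaped v (dense_cone F).
Proof.
apply: star_shaped_closure => _ t [a [b [a0 b0 ab ->]]] /andP[t0 t1].
have t'0 : 0 < 1 - t by rewrite subr_gt0.
(* Moving towards the base scales [a] and [b] alike, so the slope [b / a] is unchanged. *)
exists ((1 - t) * a), ((1 - t) * b); split; rewrite ?mulr_gt0 //.
  by rewrite -mulf_div divff ?lt0r_neq0 // mul1r.
by apply: plane_eq; rewrite /= /GRing.scale /=; ring.
Qed.

(* The Markov equation reads (D2/D1)^2 - 3 D (D2/D1) + 1 = - (D/D1)^2 < 0, so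
   the slope D2/D1 of the diagonal lies strictly between the roots that bound the
   dense cone. *)
Lemma dense_cone_apex : dense_cone F apex.
Proof.
apply: subset_closure.
exists (lam * D1 ^+ 2 * D2 / D ^+ 2), (lam * D1 * D2 ^+ 2 / D ^+ 2).
have DD0 : 0 < D ^+ 2 by exact: exprn_gt0.
split=> //; try by rewrite divr_gt0 ?mulr_gt0 ?exprn_gt0.
have -> : lam * D1 * D2 ^+ 2 / D ^+ 2 / (lam * D1 ^+ 2 * D2 / D ^+ 2) = D2 / D1.
  by field; rewrite ?D_neq0 ?D1_neq0 ?D2_neq0 ?lt0r_neq0.
(* The two slope bounds are [|2 x - 3 D| < sqrt (9 D^2 - 4)] for [x = D2 / D1]. *)
have : `|2 * (D2 / D1) - 3 * D| < Num.sqrt (9 * D ^+ 2 - 4).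
  rewrite -sqrtr_sqr ltr_sqrt.
    rewrite -subr_gt0.
    have -> : 9 * D ^+ 2 - 4 - (2 * (D2 / D1) - 3 * D) ^+ 2 =
      4 * (D / D1) ^+ 2
      + 4 / D1 ^+ 2 * (3 * D * D1 * D2 - (D ^+ 2 + D1 ^+ 2 + D2 ^+ 2)) by field.
    by rewrite markov subrr mulr0 addr0 mulr_gt0 // exprn_gt0 // divr_gt0.
  (* A positive integer is at least 1, which makes the radicand positive. *)
  have D1' : 1 <= D.
    by rewrite ler1z -gtz0_ge1 -(ltr0z R).
  by nra.
rewrite ltr_norml -/D; lra.
Qed.

(** Both cones are closed and star-shaped about the base, and on them the roof rays are the zero
    sets of the side forms, so [component_sides] applies. *)
Lemma diamondE K :
  let C := match K with Dense => dense_cone F | Outer => outer_cone F end in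
  diamond K F = [set p | [/\ C p, 0 <= side1 p & 0 <= side2 p]].
Proof.
move=> C.
have subC : C `<=` outer_cone F by rewrite /C; case: (K); first exact: dense_cone_sub.
have [v1 v2] := coord_base.
have starC : star_shaped v C.
  by rewrite /C; case: (K); [exact: star_dense_cone | exact: star_outer_cone].
have Capex : C apex.
  by rewrite /C; case: (K); [exact: dense_cone_apex | exact: outer_cone_apex].
rewrite /diamond -/C; apply: component_sides => //.
- by rewrite /C; case: (K); [exact: closed_closure | exact: closed_outer_cone].
(* The base belongs to the cone as the end of the segment that starts at the apex. *)
- by rewrite -[base F](mix1 apex); apply: starC; rewrite // ler01 lexx.
- exact: affine_side1.
- exact: affine_side2.
- by rewrite /side1 v1 v2 !mulr0 !add0r !mulr_gt0.
- by rewrite /side2 v1 v2 !mulr0 !add0r !mulr_gt0.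
- by move=> p /subC; rewrite outer_coneE => -[_ p2]; exact: ray1_side.
- by move=> p /subC; rewrite outer_coneE => -[p1 _]; exact: ray2_side.
Qed.

Lemma diamond_apex K : diamond K F apex.
Proof.
rewrite diamondE /=; have [-> ->] := side_apex; split=> //.
by case: K; [exact: dense_cone_apex | exact: outer_cone_apex].
Qed.

(** Both side forms are nonnegative on the diamond and vanish at the apex; hence they vanish at both
    ends of any segment with the apex in its interior, and the apex is their only common zero. *)
Lemma is_vertex_apex K : is_vertex (diamond K F) apex.
Proof.
split; first exact: diamond_apex.
move=> p q t; rewrite diamondE /= => -[_ p1 p2] [_ q1 q2] /andP[t0 t1] E.
have t'0 : 0 < 1 - t by rewrite subr_gt0.
have side0 f : affine_form f -> f apex = 0 -> 0 <= f p -> 0 <= f q ->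
    f p = 0 /\ f q = 0.
  move=> af f0 fp fq; move: f0; rewrite E affine_form_mix // => /eqP.
  rewrite (paddr_eq0 (mulr_ge0 (ltW t'0) fp) (mulr_ge0 (ltW t0) fq)) !mulf_eq0.
  rewrite (gt_eqF t'0) (gt_eqF t0) /=.
  by move=> /andP[/eqP -> /eqP ->].
have [s1 s2] := side_apex.
have [{}p1 {}q1] := side0 _ affine_side1 s1 p1 q1.
have [{}p2 {}q2] := side0 _ affine_side2 s2 p2 q2.
by split; exact: side_eq0.
Qed.

Lemma roofs_apex K : roof1 K F `&` roof2 K F = [set apex].
Proof.
have outer p : diamond K F p -> 0 <= coord1 p /\ 0 <= coord2 p.
  rewrite diamondE /= => -[Kp _ _].
  suff : outer_cone F p by rewrite outer_coneE.
  by case: K Kp => // /dense_cone_sub.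
apply/seteqP; split=> [p [[Kp r1] [_ r2]]|p ->].
  have [p1 p2] := outer _ Kp.
  by apply: side_eq0; [exact/ray1_side | exact/ray2_side].
have Kp := diamond_apex K; have [p1 p2] := outer _ Kp.
have [s1 s2] := side_apex.
by split; split=> //; [exact/ray1_side | exact/ray2_side].
Qed.

Lemma shear_pow_diagonal K k :
  exists u : plane R,
    [/\ is_vertex (shear_pow k @` diamond K F) u,
        (shear_pow k @` roof1 K F) `&` (shear_pow k @` roof2 K F) = [set u]
      & vertical_segment (shear_pow k (base F)) u].
Proof.
have inj := @shear_pow_inj R k.
exists (shear_pow k apex); split.
- exact: is_vertex_image (@affine_shear_pow R k) inj (is_vertex_apex K).
- apply/seteqP; split=> [_ [[p r1p <-] [q r2q /inj pq]]|_ ->].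
    have : (roof1 K F `&` roof2 K F) p by split=> //; rewrite -pq.
    by rewrite roofs_apex => ->.
  have [r1 r2] : (roof1 K F `&` roof2 K F) apex by rewrite roofs_apex.
  by split; exists apex.
- have [neq vert] := apex_above.
  by split; [move=> /inj | exact: shear_pow_vertical].
Qed.

End MarkovFrame.

(** * Rays *)

Section Rays.
Context {R : realType}.
Implicit Types (p q v : plane R) (d e : ray R) (m n : lattice) (s t : R).

Lemma primitive_bezout m : primitive m -> exists a b : int, a * m.1 + b * m.2 = 1.
Proof.
rewrite /primitive /coprimez => /eqP g1.
by have [a [b ab]] := Bezoutz m.1 m.2; exists a, b; rewrite ab.
Qed.

Lemma primitiveN m : primitive m -> primitive (- m).
Proof. by rewrite /primitive /coprimez /= gcdNz gcdzN. Qed.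

Lemma vecN m : vec (- m) = - vec m :> plane R.
Proof. by apply: plane_eq; rewrite /= rmorphN. Qed.

Lemma vec_neq0 m : primitive m -> vec m != 0 :> plane R.
Proof.
move=> /primitive_bezout[a [b E]]; apply/eqP => -[/eqP + /eqP].
by rewrite !intr_eq0 => /eqP m1 /eqP m2; move: E; rewrite m1 m2 !mulr0.
Qed.

(** Bezout for [n] makes [t] an integer; Bezout for [m] then makes it a divisor of 1, and positivity
    leaves [t = 1]. *)
Lemma primitive_vec_eq m n t : primitive m -> primitive n -> 0 < t ->
  vec m = t *: vec n :> plane R -> m = n.
Proof.
move=> pm pn t0 [E1 E2]; rewrite /GRing.scale /= in E1 E2.
have [a [b ab]] := primitive_bezout pm; have [x [y xy]] := primitive_bezout pn.
have tE : t = (x * m.1 + y * m.2)%:~R.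
  have xyR : x%:~R * n.1%:~R + y%:~R * n.2%:~R = 1 :> R.
    by rewrite -!rmorphM -rmorphD /= xy.
  transitivity (t * (x%:~R * n.1%:~R + y%:~R * n.2%:~R)).
    by rewrite xyR mulr1.
  by rewrite rmorphD !rmorphM /= E1 E2; ring.
move: tE E1 E2 t0; set z := x * _ + _ => -> /eqP + /eqP.
rewrite -!rmorphM !eqr_int ltr0z => /eqP m1 /eqP m2 z0.
have : z * (a * n.1 + b * n.2) = 1 by rewrite -ab m1 m2; ring.
move: (a * _ + _) => k zk.
have k0 : 0 < k by rewrite -(pmulr_rgt0 _ z0) zk.
have z1 : z = 1 by clearbody z; nia.
by case: (m) (n) m1 m2 => ? ? [? ?] /= -> ->; rewrite z1 !mul1r.
Qed.

Lemma prim_tangentE p q m t : primitive m -> 0 < t -> q - p = t *: vec m ->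
  prim_tangent p q = m.
Proof.
move=> pm t0 pq; apply: xget_unique; first by split=> //; exists t.
move=> n [pn [s s0]]; rewrite pq => E; apply: (@primitive_vec_eq _ _ (t / s)) => //.
  exact: divr_gt0.
by rewrite -[LHS](scalerK (lt0r_neq0 s0)) -E scalerA mulrC.
Qed.

(* the derivative of y + x^2/2 at p in the direction - m *)
Definition ascent p m : R := - (m.2%:~R + p.1 * m.1%:~R).

(** It is enough to ask for the sign at the initial point: by [ascentB] the ascent never decreases
    along the ray. *)
Definition ascending d := primitive d.2 /\ 0 <= ascent d.1 d.2.

Lemma ascentB p m t : ascent (p - t *: vec m) m = ascent p m + t * m.1%:~R ^+ 2.
Proof. by rewrite /ascent /= /GRing.scale /=; ring. Qed.

Lemma ascentN p m : ascent p (- m) = - ascent p m.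
Proof. by rewrite /ascent /= !rmorphN; ring. Qed.

Lemma ascending_ge0 d p : ascending d -> ray_set d p -> 0 <= ascent p d.2.
Proof.
by move=> [_ d0] [t t0 ->]; rewrite ascentB addr_ge0 // mulr_ge0 // sqr_ge0.
Qed.

(** If the ray is not vertical, the increment [t * m.1 ^+ 2] is positive. On a vertical ray the
    ascent is constant, and nonzero by primitivity. *)
Lemma ascending_gt0 d t : ascending d -> 0 < t -> 0 < ascent (d.1 - t *: vec d.2) d.2.
Proof.
move=> [pd d0] t0; rewrite ascentB.
have [m0|m0] := eqVneq d.2.1 0; last first.
  by rewrite ltr_wpDl // mulr_gt0 // exprn_even_gt0 //= intr_eq0.
rewrite m0 expr0n mulr0 addr0 lt_neqAle d0 andbT eq_sym /ascent m0 mulr0 addr0.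
rewrite oppr_eq0 intr_eq0; apply/eqP => m0'; move/eqP: (vec_neq0 pd); apply.
by rewrite /vec m0 m0'.
Qed.

(** The points come in the order of traversal: [q] strictly before [p]. Hence [d.2], being opposite
    to the direction, points from [p] back to [q]. *)
Definition runs d q p := exists s t,
  [/\ 0 <= s < t, q = d.1 - s *: vec d.2 & p = d.1 - t *: vec d.2].

Lemma runsB d q p : runs d q p -> exists2 t, 0 < t & q - p = t *: vec d.2.
Proof.
move=> [s [t [/andP[_ st] -> ->]]]; exists (t - s); first by rewrite subr_gt0.
by apply: plane_eq; rewrite /= /GRing.scale /=; ring.
Qed.

Lemma runs_segment d q p : runs d q p -> segment p q `<=` ray_set d.
Proof.
move=> [s [t [/andP[s0 st] -> ->]]] _ [a /andP[a0 a1] ->].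
exists ((1 - a) * t + a * s).
  by rewrite addr_ge0 ?mulr_ge0 ?subr_ge0 // (le_trans s0 (ltW st)).
by apply: plane_eq; rewrite /= /GRing.scale /=; ring.
Qed.

Lemma segment_ends p q : segment p q p /\ segment p q q.
Proof.
split; [exists 0 | exists 1]; rewrite ?mix0 ?mix1 ?lexx ?ler01 //.
Qed.

(* Two overlapping rays cannot run against each other, since y + x^2/2 increases
   along both. *)
Lemma ascending_overlap d e q p : ascending d -> ascending e -> runs d q p ->
  segment p q `<=` ray_set e -> e.2 = d.2.
Proof.
move=> ad ae dqp pqe; have [t t0 qp] := runsB dqp.
have [/pqe ep /pqe [b b0 qE]] := segment_ends p q.
have [a a0 pE] := ep.
have E : (a - b) *: vec e.2 = t *: vec d.2.
  by rewrite -qp qE pE; apply: plane_eq; rewrite /= /GRing.scale /=; ring.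
have [ab|ab|ab] := ltgtP a b.
(* Here [e] meets [p] before [q], against [d]. The ascent of [d] at [p] is positive since [p] is not
   its initial point, so that of [e] would be negative. *)
- have eN : e.2 = - d.2.
    apply: (@primitive_vec_eq _ _ (t / (b - a))); [exact: ae.1 | exact: primitiveN ad.1
      | by rewrite divr_gt0 // subr_gt0 |].
    have b0' : b - a != 0 by rewrite subr_eq0 gt_eqF.
    rewrite vecN scalerN mulrC -scalerA -E scalerA -scaleNr.
    by rewrite -mulrN opprB mulVf // scale1r.
  have := ascending_ge0 ae ep; rewrite eN ascentN oppr_ge0 leNgt.
  case: dqp => s [t' [/andP[s0 st] _ ->]].
  by rewrite ascending_gt0 // (le_lt_trans s0 st).
- apply: (@primitive_vec_eq _ _ (t / (a - b))); [exact: ae.1 | exact: ad.1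
    | by rewrite divr_gt0 // subr_gt0 |].
  have b0' : a - b != 0 by rewrite subr_eq0 gt_eqF.
  by rewrite mulrC -scalerA -E scalerA mulVf // scale1r.
- move: E; rewrite ab subrr scale0r => /esym/eqP; rewrite scaler_eq0 gt_eqF //=.
  by rewrite (negbTE (vec_neq0 ad.1)).
Qed.

(** The ray picked by [xget] need not be [d], but it overlaps [d] along the edge, and that fixes its
    opposite vector. *)
Lemma ray_through_dir (S : set (ray R)) d q p : (forall e, S e -> ascending e) ->
  S d -> runs d q p -> (ray_through S p q).2 = d.2.
Proof.
move=> aS Sd dqp; rewrite /ray_through; case: xgetP => [e _ [Se pqe]|/(_ d)[]].
  by apply: ascending_overlap dqp pqe; exact: aS.
by split=> //; exact: runs_segment.
Qed.

Lemma ray_through1 d q p : runs d q p -> ray_through [set d] p q = d.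
Proof.
by move=> dqp; apply: xget_unique => [|e []//]; split=> //; exact: runs_segment.
Qed.

Lemma meet_pointE d e p : wedge d.2 e.2 != 0 -> ray_set d p -> ray_set e p ->
  meet_point d e = p.
Proof.
move=> w0 dp ep; apply: xget_unique => // q [dq eq].
case: dp => a _ pd; case: ep => b _ pe; case: dq => a' _ qd; case: eq => b' _ qe.
have E : (a - a') *: vec d.2 = (b - b') *: vec e.2 :> plane R.
  have -> : (a - a') *: vec d.2 = q - p.
    by rewrite qd pd; apply: plane_eq; rewrite /= /GRing.scale /=; ring.
  by rewrite qe pe; apply: plane_eq; rewrite /= /GRing.scale /=; ring.
case: E; rewrite /GRing.scale /= => E1 E2.
have : (a - a') * (wedge d.2 e.2)%:~R = 0.
  rewrite /wedge rmorphB !rmorphM /= mulrBr !mulrA E1 E2; ring.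
move=> /eqP; rewrite mulf_eq0 intr_eq0 (negbTE w0) orbF subr_eq0 => /eqP aa.
by rewrite qd pd aa.
Qed.

Lemma runs_oriented d q p : runs d q p ->
  oriented_to [set d] p q /\ oriented_from [set d] q p.
Proof.
move=> dqp; have [t t0 qp] := runsB dqp.
have [pp pq] := segment_ends p q; have sub := runs_segment dqp.
have E : p - q = t *: - vec d.2 by rewrite -opprB qp scalerN.
by split; exists d => //; split; try exact: sub; exists t.
Qed.

Lemma runs_not_oriented d q p : primitive d.2 -> runs d q p ->
  ~ oriented_to [set d] q p /\ ~ oriented_from [set d] p q.
Proof.
move=> pd /runsB[t t0 qp].
have no : ~ same_direction (q - p) (- vec d.2).
  move=> [s s0]; rewrite qp => /eqP; rewrite -subr_eq0 scalerN opprK -scalerDl.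
  by rewrite scaler_eq0 (negbTE (vec_neq0 pd)) orbF gt_eqF // addr_gt0.
by split; move=> [e -> [_ /no]].
Qed.

End Rays.

(** * Triangles *)

(* A triangle with incoming vertex v and other vertices v1, v2: D, D1, D2 are the
   multiplicities of the corners, d1 and d2 the rays through the edges at v, and
   m the primitive tangent vector of the third edge, pointing from v2 to v1. *)
Record markov_triangle {R : realType} (v v1 v2 : plane R) (d1 d2 : ray R)
    (D D1 D2 : int) (m : lattice) (lam th1 th2 : R) : Prop := MarkovTriangle {
  mt_D : 0 < D;
  mt_D1 : 0 < D1;
  mt_D2 : 0 < D2;
  mt_lam : 0 < lam;
  mt_th1 : 0 <= th1;
  mt_th2 : 0 <= th2;
  mt_markov : D ^+ 2 + D1 ^+ 2 + D2 ^+ 2 = 3 * D * D1 * D2;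
  mt_wedge : `|wedge d1.2 d2.2| = D;
  mt_vertical : D1 * d1.2.1 + D2 * d2.2.1 = 0;
  mt_tangent1 : D * m.1 = D2 * d1.2.1 - D1 * d2.2.1;
  mt_tangent2 : D * m.2 = D2 * d1.2.2 - D1 * d2.2.2;
  mt_primitive : primitive m;
  mt_ascending1 : ascending d1;
  mt_ascending2 : ascending d2;
  mt_vtx1 : v1 = v + (lam * D2%:~R) *: vec d1.2;
  mt_vtx2 : v2 = v + (lam * D1%:~R) *: vec d2.2;
  mt_start1 : d1.1 = v1 + th1 *: vec d1.2;
  mt_start2 : d2.1 = v2 + th2 *: vec d2.2 }.

Lemma wedgeC m n : wedge m n = - wedge n m.
Proof. by rewrite /wedge; ring. Qed.

Lemma wedgeN m n : wedge (- m) (- n) = wedge m n.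
Proof. by rewrite /wedge /=; ring. Qed.

(** The symmetry exchanging the two ends; everything proved below for the first end transfers to the
    second through it. *)
Lemma markov_triangleC (R : realType) (v v1 v2 : plane R) d1 d2 D D1 D2 m lam th1 th2 :
  markov_triangle v v1 v2 d1 d2 D D1 D2 m lam th1 th2 ->
  markov_triangle v v2 v1 d2 d1 D D2 D1 (- m) lam th2 th1.
Proof.
case=> *; split=> //.
- lia.
- by rewrite wedgeC normrN.
- by rewrite addrC.
- by rewrite /= mulrN; lia.
- by rewrite /= mulrN; lia.
- exact: primitiveN.
Qed.

Section MarkovTriangle.
Context {R : realType} (v v1 v2 : plane R) (d1 d2 : ray R) (D D1 D2 : int).
Context (m : lattice) (lam th1 th2 : R).
Hypothesis st : markov_triangle v v1 v2 d1 d2 D D1 D2 m lam th1 th2.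

Let D_gt0 : 0 < D := mt_D st.
Let D1_gt0 : 0 < D1 := mt_D1 st.
Let D2_gt0 : 0 < D2 := mt_D2 st.
Let lam_gt0 : 0 < lam := mt_lam st.
Let DR_gt0 : 0 < D%:~R :> R. Proof. by rewrite ltr0z. Qed.
Let D1R_gt0 : 0 < D1%:~R :> R. Proof. by rewrite ltr0z. Qed.
Let D2R_gt0 : 0 < D2%:~R :> R. Proof. by rewrite ltr0z. Qed.

Lemma tangent_vec : D%:~R *: vec m = D2%:~R *: vec d1.2 - D1%:~R *: vec d2.2 :> plane R.
Proof.
apply: plane_eq; rewrite /= /GRing.scale /= -!rmorphM -rmorphB /=.
- by rewrite (mt_tangent1 st).
- by rewrite (mt_tangent2 st).
Qed.

Lemma edge1 : v1 - v = (lam * D2%:~R) *: vec d1.2.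
Proof. by rewrite (mt_vtx1 st) addrAC subrr add0r. Qed.

Lemma edge2 : v2 - v = (lam * D1%:~R) *: vec d2.2.
Proof. by rewrite (mt_vtx2 st) addrAC subrr add0r. Qed.

(** With [edge1] and [edge2] this says that the lattice length of each edge is [lam] times the
    multiplicity of the opposite corner. *)
Lemma edge21 : v1 - v2 = (lam * D%:~R) *: vec m.
Proof.
rewrite -[LHS](subrKA v) -(opprB v2) edge1 edge2 -!scalerA tangent_vec.
by rewrite scalerBr.
Qed.

Lemma prim_tangent1 : prim_tangent v v1 = d1.2.
Proof. exact: prim_tangentE (mt_ascending1 st).1 (mulr_gt0 _ _) edge1. Qed.

Lemma prim_tangent2 : prim_tangent v v2 = d2.2.
Proof. exact: prim_tangentE (mt_ascending2 st).1 (mulr_gt0 _ _) edge2. Qed.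

Lemma prim_tangent21 : prim_tangent v2 v1 = m.
Proof. exact: prim_tangentE (mt_primitive st) (mulr_gt0 _ _) edge21. Qed.

Lemma corner_mult_base : corner_mult v v1 v2 = D.
Proof. by rewrite /corner_mult prim_tangent1 prim_tangent2 (mt_wedge st). Qed.

(** Wedging [D m = D2 m1 - D1 m2] with [m1] leaves only the multiple [- D1] of the wedge of [m1] and
    [m2], whose absolute value is [D]. *)
Lemma corner_mult_end : corner_mult v1 v v2 = D1.
Proof.
rewrite /corner_mult.
have -> : prim_tangent v1 v = - d1.2.
  apply: (@prim_tangentE _ _ _ _ (lam * D2%:~R));
    [exact: primitiveN (mt_ascending1 st).1 | exact: mulr_gt0 |].
  by rewrite vecN scalerN -edge1 opprB.
have -> : prim_tangent v1 v2 = - m.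
  apply: (@prim_tangentE _ _ _ _ (lam * D%:~R));
    [exact: primitiveN (mt_primitive st) | exact: mulr_gt0 |].
  by rewrite vecN scalerN -edge21 opprB.
rewrite wedgeN; apply: (mulfI (lt0r_neq0 D_gt0)).
rewrite -{1}(gtr0_norm D_gt0) -normrM.
have -> : D * wedge d1.2 m = - (D1 * wedge d1.2 d2.2).
  rewrite /wedge mulrBr !mulrA ![D * _]mulrC -!mulrA (mt_tangent1 st) (mt_tangent2 st).
  by ring.
by rewrite normrN normrM (mt_wedge st) gtr0_norm // mulrC.
Qed.

(** * The roof ray issuing from [v1] *)

Definition roof_dir : lattice := d1.2 *~ (3 * D1) - m.

Lemma new_rayE : new_ray v v1 v2 = (v1, roof_dir).
Proof. by rewrite /new_ray prim_tangent1 corner_mult_end prim_tangent21. Qed.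

Lemma roof_dirE : (roof_dir.1 = 3 * D1 * d1.2.1 - m.1) *
  (roof_dir.2 = 3 * D1 * d1.2.2 - m.2).
Proof.
rewrite /roof_dir.
have E (a : lattice) (z : int) : a *~ z = (z * a.1, z * a.2).
  rewrite [LHS]surjective_pairing !(raddfMz fst, raddfMz snd) /=.
  by rewrite !mulrzz ![_ * z]mulrC.
by rewrite E.
Qed.

(** Eliminates [m] in favour of the two tangent vectors at the base; the factor [D] keeps the
    computation in the integers. *)
Lemma roof_dir_comb : (D * roof_dir.1 = (3 * D * D1 - D2) * d1.2.1 + D1 * d2.2.1) *
  (D * roof_dir.2 = (3 * D * D1 - D2) * d1.2.2 + D1 * d2.2.2).
Proof.
by rewrite !roof_dirE !mulrBr (mt_tangent1 st) (mt_tangent2 st); split; ring.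
Qed.

Lemma roof_dir_vec : D%:~R *: vec roof_dir =
  (3 * D%:~R * D1%:~R - D2%:~R) *: vec d1.2 + D1%:~R *: vec d2.2 :> plane R.
Proof.
apply: plane_eq; rewrite /= /GRing.scale /= -!rmorphM /= !roof_dir_comb.
- by ring.
- by ring.
Qed.

Lemma markovR : D%:~R ^+ 2 + D1%:~R ^+ 2 + D2%:~R ^+ 2
  = 3 * D%:~R * D1%:~R * D2%:~R :> R.
Proof.
transitivity ((D ^+ 2 + D1 ^+ 2 + D2 ^+ 2)%:~R : R); first by ring.
by rewrite (mt_markov st); ring.
Qed.

Lemma verticalR : D1%:~R * d1.2.1%:~R + D2%:~R * d2.2.1%:~R = 0 :> R.
Proof.
transitivity ((D1 * d1.2.1 + D2 * d2.2.1)%:~R : R); first by ring.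
by rewrite (mt_vertical st).
Qed.

(* [3 D D1 - D2] is the other root of the Markov equation in [D2]. *)
Lemma jump_gt0 : 0 < 3 * D * D1 - D2.
Proof.
rewrite -(pmulr_lgt0 _ D2_gt0).
have -> : (3 * D * D1 - D2) * D2 = D ^+ 2 + D1 ^+ 2.
  by rewrite mulrBl -(mt_markov st); ring.
by rewrite addr_gt0 // exprn_gt0.
Qed.

Let jumpR_gt0 : 0 < 3 * D%:~R * D1%:~R - D2%:~R :> R.
Proof.
have -> : 3 * D%:~R * D1%:~R - D2%:~R = (3 * D * D1 - D2)%:~R :> R by ring.
by rewrite ltr0z jump_gt0.
Qed.

Lemma wedge_roof_dir :
  D * wedge d2.2 roof_dir = - ((3 * D * D1 - D2) * wedge d1.2 d2.2).
Proof.
rewrite /wedge mulrBr mulrCA [D * (d2.2.2 * _)]mulrCA !roof_dir_comb; ring.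
Qed.

(** A common divisor of the two entries divides the wedge with [d1.2], which is [D1] up to sign;
    hence it divides [m = 3 D1 m1 - roof_dir], which is primitive. *)
Lemma primitive_roof_dir : primitive roof_dir.
Proof.
have wE : `|wedge d1.2 roof_dir| = D1.
  apply: (mulfI (lt0r_neq0 D_gt0)).
  rewrite -{1}(gtr0_norm D_gt0) -normrM.
  have -> : D * wedge d1.2 roof_dir = D1 * wedge d1.2 d2.2.
    by rewrite /wedge mulrBr mulrCA [D * (d1.2.2 * _)]mulrCA !roof_dir_comb; ring.
  by rewrite normrM (mt_wedge st) gtr0_norm // mulrC.
rewrite /primitive /coprimez; set g := gcdz _ _.
have g1 : (g %| roof_dir.1)%Z by exact: dvdz_gcdl.
have g2 : (g %| roof_dir.2)%Z by exact: dvdz_gcdr.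
have gD1 : (g %| D1)%Z.
  have [->|->] : D1 = wedge d1.2 roof_dir \/ D1 = - wedge d1.2 roof_dir by lia.
    by rewrite /wedge rpredB // dvdz_mull.
  by rewrite rpredN /wedge rpredB // dvdz_mull.
have : (g %| gcdz m.1 m.2)%Z.
  rewrite dvdz_gcd; apply/andP; split.
  - have -> : m.1 = 3 * D1 * d1.2.1 - roof_dir.1 by rewrite roof_dirE; ring.
    by rewrite rpredB // dvdz_mulr // dvdz_mull.
  - have -> : m.2 = 3 * D1 * d1.2.2 - roof_dir.2 by rewrite roof_dirE; ring.
    by rewrite rpredB // dvdz_mulr // dvdz_mull.
by rewrite (eqP (mt_primitive st)) dvdz1.
Qed.

Lemma runs1 : runs d1 v1 v.
Proof.
exists th1, (th1 + lam * D2%:~R); split.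
- by rewrite (mt_th1 st) ltrDl mulr_gt0.
- by rewrite (mt_start1 st) addrK.
- rewrite (mt_start1 st) (mt_vtx1 st).
  by apply: plane_eq; rewrite /= /GRing.scale /=; ring.
Qed.

(** By [roof_dir_vec] the ascent of the roof ray at [v1] is a positive combination of those of
    [d1.2] and [d2.2] there. *)
Lemma ascending_new_ray : ascending (new_ray v v1 v2).
Proof.
rewrite new_rayE; split; first exact: primitive_roof_dir.
have a1 : 0 <= ascent v1 d1.2.
  apply: (ascending_ge0 (mt_ascending1 st)).
  by have [s [t [/andP[s0 _] E _]]] := runs1; exists s.
have a2 : 0 <= ascent v d2.2.
  apply: (ascending_ge0 (mt_ascending2 st)).
  exists (th2 + lam * D1%:~R); first by rewrite addr_ge0 ?(mt_th2 st) ?ltW ?mulr_gt0.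
  rewrite (mt_start2 st) (mt_vtx2 st).
  by apply: plane_eq; rewrite /= /GRing.scale /=; ring.
(* The ray [d2] gives its ascent at [v], not at [v1]. Since [D1 m1 + D2 m2] is vertical, the change
   from [v] to [v1] is a square times [lam]. *)
have a2' : D1%:~R * ascent v1 d2.2 =
    D1%:~R * ascent v d2.2 + lam * (D2%:~R * d2.2.1%:~R) ^+ 2.
  have E : D1%:~R * d1.2.1%:~R = - (D2%:~R * d2.2.1%:~R) :> R.
    by apply/eqP; rewrite -addr_eq0 verticalR.
  transitivity (D1%:~R * ascent v d2.2
    - lam * (D2%:~R * d2.2.1%:~R) * (D1%:~R * d1.2.1%:~R)).
    by rewrite {1}(mt_vtx1 st) /ascent /= /GRing.scale /=; ring.
  by rewrite E; ring.
rewrite /= -(pmulr_rge0 _ DR_gt0).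
have -> : D%:~R * ascent v1 roof_dir =
  (3 * D%:~R * D1%:~R - D2%:~R) * ascent v1 d1.2 + D1%:~R * ascent v1 d2.2.
  case: roof_dir_vec => E1 E2; rewrite /GRing.scale /= in E1 E2.
  rewrite /ascent mulrN mulrDr mulrCA E1 E2; ring.
rewrite a2'; apply: addr_ge0; first exact: mulr_ge0 (ltW jumpR_gt0) a1.
exact: addr_ge0 (mulr_ge0 (ltW D1R_gt0) a2) (mulr_ge0 (ltW lam_gt0) (sqr_ge0 _)).
Qed.

(** The point of [d2] beyond [v] where the roof ray from [v1] arrives. Its distance from [v] is the
    new scale times [D1], the multiplicity of the opposite corner [v1]. *)
Let v' : plane R := v - (lam * D1%:~R * D2%:~R / (3 * D * D1 - D2)%:~R) *: vec d2.2.

(** The Vieta jump. The old edge from [v1] to [v] becomes the edge opposite to the incoming vertex,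
    so its length [lam * D2] is the new scale times [3 * D * D1 - D2]. The ray [d2] passes [v] at
    time [lam * D1 + th2], and the roof ray starts at [v1], hence the time 0. *)
Lemma markov_triangle_child :
  markov_triangle v' v v1 d2 (new_ray v v1 v2) (3 * D * D1 - D2) D D1 (- d1.2)
    (lam * D2%:~R / (3 * D * D1 - D2)%:~R) (lam * D1%:~R + th2) 0.
Proof.
have jR_gt0 : 0 < (3 * D * D1 - D2)%:~R :> R by rewrite ltr0z jump_gt0.
have jE : (3 * D * D1 - D2)%:~R = 3 * D%:~R * D1%:~R - D2%:~R :> R by ring.
have jR_neq0 := lt0r_neq0 jumpR_gt0.
split=> //; rewrite ?new_rayE /=.
- exact: jump_gt0.
- by rewrite divr_gt0 // mulr_gt0.
- by rewrite addr_ge0 ?(mt_th2 st) // mulr_ge0 // ltW.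
- apply/eqP; rewrite -subr_eq0; apply/eqP.
  transitivity (D ^+ 2 + D1 ^+ 2 + D2 ^+ 2 - 3 * D * D1 * D2); first by ring.
  by rewrite (mt_markov st) subrr.
- apply: (mulfI (lt0r_neq0 D_gt0)); rewrite -{1}(gtr0_norm D_gt0) -normrM.
  by rewrite wedge_roof_dir normrN normrM (mt_wedge st) (gtr0_norm jump_gt0) mulrC.
(* Up to the factor [D], the new vertical relation is the old one times [3 * D * D1 - D2] plus a
   multiple of the Markov equation. *)
- apply: (mulfI (lt0r_neq0 D_gt0)); rewrite mulr0 mulrDr [D * (D1 * _)]mulrCA.
  rewrite roof_dir_comb.
  transitivity ((D ^+ 2 + D1 ^+ 2 + D2 ^+ 2 - 3 * D * D1 * D2) * d2.2.1
    + (3 * D * D1 - D2) * (D1 * d1.2.1 + D2 * d2.2.1)); first by ring.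
  by rewrite (mt_markov st) (mt_vertical st) subrr mul0r mulr0 addr0.
- by rewrite roof_dir_comb; ring.
- by rewrite roof_dir_comb; ring.
- exact: primitiveN (mt_ascending1 st).1.
- exact: mt_ascending2 st.
- by rewrite -new_rayE; exact: ascending_new_ray.
- rewrite /v' -addrA -scaleNr -scalerDl.
  rewrite jE; have -> : - (lam * D1%:~R * D2%:~R / (3 * D%:~R * D1%:~R - D2%:~R)) +
    lam * D2%:~R / (3 * D%:~R * D1%:~R - D2%:~R) * D1%:~R = 0 :> R by field.
  by rewrite scale0r addr0.
- rewrite -scalerA roof_dir_vec (mt_vtx1 st) /v'.
  by rewrite jE; apply: plane_eq; rewrite /= /GRing.scale /=; field.
- rewrite (mt_start2 st) (mt_vtx2 st).
  by apply: plane_eq; rewrite /= /GRing.scale /=; ring.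
- by rewrite scale0r addr0.
Qed.

End MarkovTriangle.

(** Both rays pass through the explicit vertex found above and are not parallel, so [meet_point]
    selects it. *)
Lemma meet_point_child (R : realType) (v v1 v2 : plane R) d1 d2 D D1 D2 m lam th1 th2 :
  markov_triangle v v1 v2 d1 d2 D D1 D2 m lam th1 th2 ->
  exists D' m' lam' th1' th2', markov_triangle (meet_point d2 (new_ray v v1 v2)) v v1
    d2 (new_ray v v1 v2) D' D D1 m' lam' th1' th2'.
Proof.
move=> st; have st' := markov_triangle_child st.
rewrite (meet_pointE _ (runs_segment (runs1 st') (segment_ends _ _).1)
  (runs_segment (runs1 (markov_triangleC st')) (segment_ends _ _).1)).
  by do 5 eexists; exact: st'.
by rewrite -normr_gt0 (mt_wedge st') (mt_D st').
Qed.

Lemma markov_triangle_frame (R : realType) (v v1 v2 : plane R) d1 d2 D D1 D2 m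
    lam th1 th2 :
  markov_triangle v v1 v2 d1 d2 D D1 D2 m lam th1 th2 ->
  markov_frame (Frame v (corner_mult v v1 v2) d1.2 d2.2
    (new_ray v v1 v2) (new_ray v v2 v1)) D1%:~R D2%:~R lam 0 0.
Proof.
move=> st; have st' := markov_triangleC st.
split; rewrite ?(corner_mult_base st) ?(new_rayE st) ?(new_rayE st') //=.
- by rewrite ltr0z (mt_D st).
- by rewrite ltr0z (mt_D1 st).
- by rewrite ltr0z (mt_D2 st).
- exact: mt_lam st.
- exact: markovR st.
- by rewrite -normr_gt0 (mt_wedge st) (mt_D st).
- exact: verticalR st.
- exact: roof_dir_vec st.
- by rewrite (roof_dir_vec st') addrC.
- by rewrite scale0r addr0 (mt_vtx1 st).
- by rewrite scale0r addr0 (mt_vtx2 st).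
Qed.

(** * The tree *)

Section Tree.
Context {R : realType}.
Implicit Types (p q r v : plane R) (d e c : ray R) (S : set (ray R)).

Let i0 : 'I_3 := ord0.
Let i1 : 'I_3 := @Ordinal 3 1 isT.
Let i2 : 'I_3 := @Ordinal 3 2 isT.

Lemma ord3_cases (i : 'I_3) : [\/ i = i0, i = i1 | i = i2].
Proof.
by case: i => -[|[|[|//]]] ?; [constructor 1 | constructor 2 | constructor 3];
  apply: val_inj.
Qed.

(** The rays [d] and [e] leave [q] and [r], so only the vertex 0 is incoming and just the order of
    the two ends is open. The second case keeps the label condition that can refute it. *)
Lemma matching_in0 p q r S d e (l : bool -> label) :
  primitive d.2 -> primitive e.2 -> runs d q p -> runs e r p ->
  let T := mk_triangle p q r S [set e] [set d] in
  has_label T i1 (l true) -> has_label T i2 (l false) ->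
  matching T l = (i0, i1, i2) \/
  matching T l = (i0, i2, i1) /\ has_label T i2 (l true).
Proof.
move=> pd pe dqp erp T l1 l2.
have [nd _] := runs_not_oriented pd dqp; have [ne _] := runs_not_oriented pe erp.
have [od _] := runs_oriented dqp; have [oe _] := runs_oriented erp.
have in0 : incoming T i0.
  move=> j k; case: (ord3_cases j) => ->; case: (ord3_cases k) => -> //= _.
have nin1 : ~ incoming T i1 by move=> /(_ i0 i2 isT).
have nin2 : ~ incoming T i2 by move=> /(_ i0 i1 isT).
rewrite /matching; case: xgetP => [[[i j] k] _ [/= u ini lj lk]|].
  case: (ord3_cases i) u ini => -> u // _.
  case: (ord3_cases j) u lj => ->; case: (ord3_cases k) => -> // _ lj;
    by [left | right].
by move=> /(_ (i0, i1, i2)) [].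
Qed.

(** The third edge runs from [r] to [q], so [r] is outgoing and [q] hybrid; exchanging them would
    require an outgoing vertex to be hybrid. *)
Lemma matching_child p q r c d e w b : primitive d.2 -> primitive e.2 ->
  primitive c.2 -> runs d q p -> runs e r p -> runs c r q ->
  matching (mk_triangle p q r [set c] [set e] [set d]) (edge_label (b :: w)) =
  (i0, i1, i2).
Proof.
move=> pd pe pc dqp erp crq.
have [nd _] := runs_not_oriented pd dqp; have [_ nc] := runs_not_oriented pc crq.
have [_ oe] := runs_oriented erp; have [_ oc] := runs_oriented crq.
set T := mk_triangle _ _ _ _ _ _.
have out2 : outgoing T i2.
  by move=> j k; case: (ord3_cases j) => ->; case: (ord3_cases k) => -> //= _.
have hyb1 : hybrid T i1.
  by split; [move=> /(_ i0 i2 isT) | move=> /(_ i2 i0 isT)].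
have [//|[_ []]] := matching_in0 (l := edge_label (b :: w)) pd pe dqp erp hyb1 out2.
by move=> _ /(_ out2).
Qed.

(** The induction invariant along the tree. Only the sides at the incoming vertex are required to be
    single rays: the bottom edge of the root is covered by two. *)
Definition state_of S (T : triangle R) (l : bool -> label) : Prop :=
  exists d1 d2 D D1 D2 m lam th1 th2,
    [/\ markov_triangle (vtx T (in_index T l)) (vtx T (end_index T l true))
          (vtx T (end_index T l false)) d1 d2 D D1 D2 m lam th1 th2,
        sides T (end_index T l false) = [set d1],
        sides T (end_index T l true) = [set d2], S d1 & S d2].

Lemma state_child S T l b w :
  S (child_ray T l true) -> S (child_ray T l false) ->
  state_of S T l -> state_of S (child_triangle T l b) (edge_label (b :: w)).
Proof.
move=> St Sf [d1 [d2 [D [D1 [D2 [m [lam [th1 [th2 [st s1 s2 S1 S2]]]]]]]]]].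
pose v := vtx T (in_index T l).
(* One child is treated for an arbitrary order of the ends; the other follows from
   [markov_triangleC]. *)
have step vj vj' dj dj' E E1 E2 m' mu t1 t2 :
    markov_triangle v vj vj' dj dj' E E1 E2 m' mu t1 t2 ->
    S dj' -> S (new_ray v vj vj') ->
    state_of S (mk_triangle (meet_point dj' (new_ray v vj vj')) v vj
      [set dj] [set new_ray v vj vj'] [set dj']) (edge_label (b :: w)).
  move=> sj Sj' Sw; have [E' [n [nu [u1 [u2 sc]]]]] := meet_point_child sj.
  set T' := mk_triangle _ _ _ _ _ _.
  have match' : matching T' (edge_label (b :: w)) = (i0, i1, i2).
    apply: matching_child; [exact: (mt_ascending1 sc).1 | exact: (mt_ascending2 sc).1
      | exact: (mt_ascending1 sj).1 | exact: runs1 sc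
      | exact: runs1 (markov_triangleC sc) | exact: runs1 sj].
  exists dj', (new_ray v vj vj'), E', E, E1, n, nu, u1, u2.
  by rewrite /in_index /end_index match'.
have r1 := runs1 st; have r2 := runs1 (markov_triangleC st).
have E1 : ray_through [set d1] v (vtx T (end_index T l true)) = d1.
  exact: ray_through1.
have E2 : ray_through [set d2] v (vtx T (end_index T l false)) = d2.
  exact: ray_through1.
case: b step => step.
- rewrite /child_triangle /= s1 s2 -/v E1 E2.
  exact: step st S2 St.
- rewrite /child_triangle /= s1 s2 -/v E1 E2.
  exact: step (markov_triangleC st) S1 Sf.
Qed.

Definition diagram_rays : set (ray R) :=
  [set ray_plus (- 1); ray_minus 1] `|` discrete_rays.

(** The Markov triple (2, 1, 1). The rays start at (-1, -1/2) and (1, -1/2) and reach the bottom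
    vertices at time 1/2. *)
Lemma root_markov_triangle :
  markov_triangle (0, 1 / 2) (- (1 / 2), 0) (1 / 2, 0) (ray_plus (- 1)) (ray_minus 1)
    2 1 1 (- 1, 0) (1 / 2) (1 / 2) (1 / 2 : R).
Proof.
split=> //=.
- by split; rewrite // /ascent /=; lra.
- by split; rewrite // /ascent /=; lra.
- by apply: plane_eq; rewrite /= /GRing.scale /=; field.
- by apply: plane_eq; rewrite /= /GRing.scale /=; field.
- by apply: plane_eq; rewrite /= /GRing.scale /=; field.
- by apply: plane_eq; rewrite /= /GRing.scale /=; field.
Qed.

Lemma state_root : state_of diagram_rays (tree_triangle [::]) (edge_label [::]).
Proof.
have st := root_markov_triangle; have st' := markov_triangleC st.
have r1 := runs1 st; have r2 := runs1 st'.
have p1 := (mt_ascending1 st).1; have p2 := (mt_ascending2 st).1.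
have S1 : diagram_rays (ray_plus (- 1)) by left; left.
have S2 : diagram_rays (ray_minus 1) by left; right.
have [n1 _] := runs_not_oriented p1 r1; have [n2 _] := runs_not_oriented p2 r2.
rewrite /state_of /in_index /end_index /=.
set T := root_triangle.
have hyb1 : hybrid T i1.
  split; first by move=> /(_ i0 i2 isT).
  (* Of the two rays covering the bottom edge, one misses this vertex and the other runs towards it,
     so the vertex is not outgoing. *)
  move=> /(_ i2 i0 isT) [d [] -> /= [[t t0]]].
  - by case; rewrite /GRing.scale /=; lra.
  - by move=> _ [s s0 []]; rewrite /GRing.scale /=; lra.
have hyb2 : hybrid T i2.
  split; first by move=> /(_ i0 i1 isT).
  move=> /(_ i1 i0 isT) [d [] -> /= [[t t0]]].
  - by move=> _ [s s0 []]; rewrite /GRing.scale /=; lra.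
  - by case; rewrite /GRing.scale /=; lra.
(* Both ends are hybrid, so either matching may have been chosen; the two are mirror images. *)
have [->|[-> _]] := matching_in0 (l := edge_label [::]) p1 p2 r1 r2 hyb1 hyb2.
- by exists (ray_plus (- 1)), (ray_minus 1); do 7 eexists; split; first exact: st.
- by exists (ray_minus 1), (ray_plus (- 1)); do 7 eexists; split; first exact: st'.
Qed.

Lemma state_tree w : state_of diagram_rays (tree_triangle w) (edge_label w).
Proof.
elim: w => [|b w IH]; first exact: state_root.
by apply: state_child IH; right; exists w; [exists true | exists false].
Qed.

Lemma ascending_diagram d : diagram_rays d -> ascending d.
Proof.
move=> [[]->|[w [b ->]]].
- exact: mt_ascending1 root_markov_triangle.
- exact: mt_ascending2 root_markov_triangle.
have [d1 [d2 [D [D1 [D2 [m [lam [th1 [th2 [st _ _ _ _]]]]]]]]]] := state_tree w.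
case: b; first exact: ascending_new_ray st.
exact: ascending_new_ray (markov_triangleC st).
Qed.

Lemma triangle_frame_markov w : exists D1 D2 lam th1 th2,
  markov_frame (triangle_frame w : frame R) D1 D2 lam th1 th2.
Proof.
have [d1 [d2 [D [D1 [D2 [m [lam [th1 [th2 [st _ _ S1 S2]]]]]]]]]] := state_tree w.
do 5 eexists; rewrite /triangle_frame.
rewrite (ray_through_dir ascending_diagram S1 (runs1 st)).
rewrite (ray_through_dir ascending_diagram S2 (runs1 (markov_triangleC st))).
exact: markov_triangle_frame st.
Qed.

(** Both rays reach the base at time 1/2. The end of the first edge is virtual: [base + opp1] lies
    on the line of [ray_plus n] behind its initial point, and [ray_plus (n - 1)] passes there at
    time 1/2; the other side is symmetric. *)
Lemma initial_frame_markov n :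
  markov_frame (initial_frame n : frame R) 1 1 1 (1 / 2) (1 / 2).
Proof.
have -> : (initial_frame n : frame R) =
    Frame (n%:~R + 1 / 2, - (n%:~R * (n%:~R + 1)) / 2) 1 (- 1, n) (1, - (n + 1))
      (ray_plus (n - 1)) (ray_minus (n + 2)).
  rewrite /initial_frame; congr Frame; apply: meet_pointE.
  - by rewrite /wedge /=; lia.
  - exists (1 / 2); first by lra.
    by apply: plane_eq; rewrite /= /GRing.scale /=; field.
  - exists (1 / 2); first by lra.
    by apply: plane_eq; rewrite /= /GRing.scale /=; field.
split=> //=.
- by ring.
- by rewrite /wedge /=; lia.
- by ring.
- by apply: plane_eq; rewrite /= /GRing.scale /=; ring.
- by apply: plane_eq; rewrite /= /GRing.scale /=; ring.
- by apply: plane_eq; rewrite /= /GRing.scale /=; field.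
- by apply: plane_eq; rewrite /= /GRing.scale /=; field.
Qed.

End Tree.

Theorem theorem5p1 (R : realType) (F : frame R) (hF : is_frame F)
    (K : diamond_kind) (k : int) :
  exists u : plane R,
    [/\ is_vertex (shear_pow k @` diamond K F) u,
        (shear_pow k @` roof1 K F) `&` (shear_pow k @` roof2 K F) = [set u]
      & vertical_segment (shear_pow k (base F)) u].
Proof.
case: hF => [[w ->]|[n ->]].
- have [D1 [D2 [lam [th1 [th2 mF]]]]] := @triangle_frame_markov R w.
  exact: shear_pow_diagonal mF K k.
- exact: shear_pow_diagonal (@initial_frame_markov R n) K k.
Qed.
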